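(* Let $d\geqslant 3$ be an odd integer and let $n>1$ be an integer with $n\equiv 1\pmod{d}$. Then, modulo $(1-aq^n)(a-q^n)$, $$\sum_{k=0}^{n-1}[2dk-1]\frac{(a^{d-1}q^{-1}, a^{d-3}q^{-1},\ldots, a^2q^{-1};q^d)_k\,(a^{1-d}q^{-1}, a^{3-d}q^{-1},\ldots,a^{-2}q^{-1};q^d)_k\, (q^{-1};q^d)_k}{(a^{d-2}q^d, a^{d-4}q^d,\ldots,aq^d;q^d)_k\,(a^{2-d}q^d, a^{4-d}q^d,\ldots, a^{-1}q^d;q^d)_k\, (q^d;q^d)_k}\,q^{\frac{d(d-1)k}{2}}\equiv 0.$$
   Context: Here $q$ and $a$ are independent indeterminates. Notation: $(x;q)_k=(1-x)(1-xq)\cdots(1-xq^{k-1})$ for $k\ge 1$, $(x;q)_0=1$, and $(x_1,\ldots,x_m;q)_k=(x_1;q)_k\cdots(x_m;q)_k$ (so $(x;q^d)_k=\prod_{i=0}^{k-1}(1-xq^{di})$). For an integer $m$ (possibly negative), $[m]=\frac{1-q^m}{1-q}$; in particular $[-1]=-q^{-1}$. In each list the exponents of $a$ change in steps of $2$: the exponents of $a$ in the numerator are $\pm2,\pm4,\ldots,\pm(d-1)$ and $0$, and in the denominator they are $\pm1,\pm3,\ldots,\pm(d-2)$ and $0$. For a rational function $A(a,q)$ and a polynomial $P(a,q)$, $A\equiv 0$ modulo $P$ means that $A=PU/V$ with polynomials $U,V$ in $a,q$ (over $\mathbb{Q}$), where $V$ is relatively prime to $P$. *)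

(* Defs.v *)
From HB Require Import structures.
From mathcomp Require Import all_boot all_order all_algebra.

Set Implicit Arguments.
Unset Strict Implicit.
Unset Printing Implicit Defensive.

Import GRing.Theory.
Local Open Scope ring_scope.

(* Q[a, q] is encoded as Q[q][a]: the outer variable is a, the inner one q. *)
Notation Qaq := {poly {poly rat}}.
Definition pola : Qaq := 'X.
Definition polq : Qaq := ('X)%:P.

Notation Qaq_frac := {fraction Qaq}.
Definition rata : Qaq_frac := tofrac pola.
Definition ratq : Qaq_frac := tofrac polq.

(* coprimep is not suitable here: over the coefficient ring Q[q] it ignores
   common factors that lie in Q[q]. *)
Definition relatively_prime (R : unitRingType) (P V : R) : Prop :=
  forall D : R, (exists E, P = D * E) -> (exists E, V = D * E) ->
    D \is a GRing.unit.

Definition eqv0_mod (A : Qaq_frac) (P : Qaq) : Prop :=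
  exists U V : Qaq, [/\ V != 0, relatively_prime V P
    & A = tofrac (P * U) / tofrac V].

Definition qpoch (F : fieldType) (x q : F) (k : nat) : F :=
  \prod_(i < k) (1 - x * q ^+ i).

Definition qpochs (F : fieldType) (xs : seq F) (q : F) (k : nat) : F :=
  \prod_(x <- xs) qpoch x q k.

Definition qint (F : fieldType) (q : F) (m : int) : F :=
  (1 - q ^ m) / (1 - q).

(* Main.v *)
Require Import Defs.
From HB Require Import structures.
From mathcomp Require Import all_boot all_order all_algebra.
From mathcomp Require Import zify ring.

(** The modulus vanishes exactly at a = q^n and a = q^-n, so the congruence says
that the sum becomes 0 at these two values of a, where its denominators stay
nonzero. The sum does not change under a -> 1/a, so a = q^n suffices.

Put d = 2h+1, n = d(m+1)+1 and Q = q^d. At a = q^n we have a = Q^(m+1) q, so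
a^j q^-1 = (a^(j-1) Q) Q^m: every numerator base is Q^m times the denominator
base one step below in the exponent of a, except for the lowest one,
a^(1-d) q^-1 = Q^-N with N = 2h(m+1)+1, which faces the denominator (Q;Q)_k.
Since (x Q^m;Q)_k / (x;Q)_k = (x Q^k;Q)_m / (x;Q)_m is a polynomial of degree m
in Q^k ([qpoch_shift]), the k-th term is, up to a factor free of k,

  (Q^-N;Q)_k / (Q;Q)_k * p(Q^k),

with p(z) = z^h (1 - z^2/q) times 2h polynomials of degree at most m
([summandE]). As h >= 1, we get p(0) = 0 and
deg p <= h + 2 + 2hm <= 2h(m+1)+1 = N, and the weights (Q^-N;Q)_k / (Q;Q)_k
annihilate z, z^2, ..., z^N ([signed_qbinom_moment]). Hence the sum is 0
([summand_sum0]).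

To return to Q(a,q), [specializes] records that a fraction takes given values
under several ring morphisms at once, through one representation U/V whose
denominator V none of them kills. If A = U/V takes the value 0 at both points,
pseudo-division of U by the modulus leaves a remainder of degree at most 1 in a
with two roots, that is 0 ([modulus_divides]); and V, nonzero at both points, is
relatively prime to the modulus ([relatively_prime_modulus]). *)

Set Implicit Arguments.
Unset Strict Implicit.
Unset Printing Implicit Defensive.

Import GRing.Theory.
Local Open Scope ring_scope.

(** * Vanishing moments of the signed q-binomial coefficients *)

Section SignedQBinomial.
Variables (F : fieldType) (q : F).

Lemma qpochS x k : qpoch x q k.+1 = qpoch x q k * (1 - x * q ^+ k).
Proof. by rewrite /qpoch big_ord_recr. Qed.

Lemma qpoch_split x k l : qpoch x q (k + l) = qpoch x q k * qpoch (x * q ^+ k) q l.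
Proof.
rewrite /qpoch big_split_ord /=; congr (_ * _).
by apply: eq_bigr => i _; rewrite exprD mulrA.
Qed.

(** Both sides are the product of the factors 1 - x q^i for i < k + m. *)
Lemma qpoch_shift x m k : qpoch (x * q ^+ m) q k * qpoch x q m
   = qpoch (x * q ^+ k) q m * qpoch x q k.
Proof. by rewrite mulrC -qpoch_split addnC qpoch_split mulrC. Qed.

Lemma qpoch_vanish N k : q != 0 -> (N < k)%N -> qpoch (q ^- N) q k = 0.
Proof.
move=> q0 Nk; apply/eqP; rewrite prodf_seq_eq0; apply/hasP.
by exists (Ordinal Nk); rewrite ?mem_index_enum //= mulVf ?expf_neq0 // subrr eqxx.
Qed.

Hypothesis q0 : q != 0.
Hypothesis qn1 : forall i, (0 < i)%N -> q ^+ i != 1.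

Lemma qpochq_neq0 k : qpoch q q k != 0.
Proof.
apply/prodf_neq0 => i _; rewrite -exprS subr_eq0 eq_sym; exact: qn1.
Qed.

Lemma expq_inj : injective (fun i : nat => q ^+ i).
Proof.
have ltP i j : (i < j)%N -> q ^+ i != q ^+ j.
  move=> ij; rewrite -(subnKC (ltnW ij)) exprD -[X in X != _]mulr1.
  by rewrite (inj_eq (mulfI (expf_neq0 _ q0))) eq_sym qn1 ?subn_gt0.
move=> i j /= /eqP E; have [/ltP|/ltP|//] := ltngtP i j; last rewrite eq_sym.
all: by rewrite E.
Qed.

(** This is (-1)^k q^(k(k-1)/2 - Nk) times the Gaussian binomial N over k. *)
Definition signed_qbinom N k := qpoch (q ^- N) q k / qpoch q q k.

Lemma signed_qbinom_rec N k :
  signed_qbinom N k.+1 * (1 - q ^+ k.+1) = signed_qbinom N k * (1 - q ^- N * q ^+ k).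
Proof.
have h := qpochq_neq0 k; have h' : 1 - q * q ^+ k != 0.
  by rewrite -exprS subr_eq0 eq_sym qn1.
by rewrite /signed_qbinom !qpochS exprS; field; rewrite h h' expf_neq0.
Qed.

(** The q-difference equation F(x) - F(qx) = x (F(x) - q^-N F(qx)) of the
generating polynomial F of the coefficients: compare the coefficients of x^k by
[signed_qbinom_rec]. *)
Lemma signed_qbinom_functional N n x : (N < n)%N ->
  (1 - x) * \sum_(0 <= k < n) signed_qbinom N k * x ^+ k
  = (1 - x * q ^- N) * \sum_(0 <= k < n) signed_qbinom N k * (q * x) ^+ k.
Proof.
move=> Nn.
(* Truncation after l terms leaves one boundary term, which is 0 once l > N. *)
have E l : (1 - x) * (\sum_(0 <= k < l) signed_qbinom N k * x ^+ k)
  - (1 - x * q ^- N) * (\sum_(0 <= k < l) signed_qbinom N k * (q * x) ^+ k)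
  = - (signed_qbinom N l * (1 - q ^+ l) * x ^+ l).
  elim: l => [|l IH]; first by rewrite !big_geq // expr0; ring.
  rewrite signed_qbinom_rec !big_nat_recr //= !mulrDr opprD addrACA IH exprMn exprS.
  by ring.
apply/eqP; rewrite -subr_eq0 E /signed_qbinom qpoch_vanish // !mul0r oppr0 //.
Qed.

(** At x = q^s the functional equation reads
(1 - q^s) F(q^s) = (1 - q^(s-N)) F(q^(s+1)). Its left side is 0 for s = 0, and
the factor on the right is nonzero for s < N, so the zeros propagate from
s = 1 to s = N. *)
Lemma signed_qbinom_moment N n s : (N < n)%N -> (0 < s <= N)%N ->
  \sum_(0 <= k < n) signed_qbinom N k * q ^+ s ^+ k = 0.
Proof.
move=> Nn; elim: s => // s IH /andP [_ sN].
have H := signed_qbinom_functional (q ^+ s) Nn.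
have L : (1 - q ^+ s) * \sum_(0 <= k < n) signed_qbinom N k * q ^+ s ^+ k = 0.
  case: s IH sN {H} => [|s] IH sN; first by rewrite expr0 subrr mul0r.
  by rewrite IH ?mulr0 //= ltnW.
move/esym/eqP: H; rewrite L mulf_eq0 -exprS => /orP [|/eqP //].
rewrite subr_eq0 eq_sym -(subnKC (ltnW sN)) exprD invfM mulrA mulfV ?expf_neq0 // mul1r.
by rewrite invr_eq1 (negPf (qn1 _)) // subn_gt0.
Qed.

Lemma signed_qbinom_annihilates N n (p : {poly F}) :
  (N < n)%N -> p`_0 = 0 -> (size p <= N.+1)%N ->
  \sum_(0 <= k < n) signed_qbinom N k * p.[q ^+ k] = 0.
Proof.
move=> Nn p0 sp.
under eq_bigr => k _ do rewrite (horner_coef_wide _ sp) mulr_sumr.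
rewrite exchange_big big1 //= => -[[|s] hs] _ /=.
  by rewrite big1 // => k _; rewrite p0 mul0r mulr0.
under eq_bigr => k _ do rewrite mulrCA -exprM mulnC exprM.
by rewrite -mulr_sumr signed_qbinom_moment ?mulr0.
Qed.
End SignedQBinomial.

Definition qpoch_poly (F : fieldType) (x q : F) k : {poly F} :=
  \prod_(i < k) (1 - (x * q ^+ i) *: 'X).

Lemma horner_qpoch_poly (F : fieldType) (x q z : F) k :
  (qpoch_poly x q k).[z] = qpoch (x * z) q k.
Proof.
rewrite /qpoch_poly horner_prod; apply: eq_bigr => i _.
by rewrite !hornerE mulrAC.
Qed.

Lemma size_prod_ord_leq (F : fieldType) s k (G : 'I_k -> {poly F}) :
  (forall i, size (G i) <= s.+1)%N -> (size (\prod_i G i)%R <= (k * s).+1)%N.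
Proof.
move=> sG; apply: leq_trans (size_poly_prod_leq _ _) _.
rewrite cardT size_enum_ord leq_subLR.
have : (\sum_i size (G i) <= k * s.+1)%N.
  by rewrite -[k in (k * _)%N]card_ord -sum_nat_const leq_sum.
by rewrite mulnS; lia.
Qed.

Lemma size_qpoch_poly (F : fieldType) (x q : F) k : (size (qpoch_poly x q k) <= k.+1)%N.
Proof.
rewrite -[k in k.+1]muln1; apply: size_prod_ord_leq => i.
rewrite (leq_trans (size_polyD _ _)) // size_polyN size_polyC oner_neq0 geq_max /=.
by rewrite (leq_trans (size_scale_leq _ _)) ?size_polyX.
Qed.

(** * The sum and its symmetry under inversion of a *)

Definition denominator (F : fieldType) (d : nat) (a q : F) k :=
  qpochs [seq a ^+ j * q ^+ d | j <- index_iota 1 d & odd j] (q ^+ d) k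
  * qpochs [seq a ^- j * q ^+ d | j <- index_iota 1 d & odd j] (q ^+ d) k
  * qpoch (q ^+ d) (q ^+ d) k.

Definition summand (F : fieldType) (d : nat) (a q : F) k :=
  qint q ((2 * d * k)%N%:Z - 1)
  * (qpochs [seq a ^+ j * q^-1 | j <- index_iota 1 d & ~~ odd j] (q ^+ d) k
     * qpochs [seq a ^- j * q^-1 | j <- index_iota 1 d & ~~ odd j] (q ^+ d) k
     * qpoch q^-1 (q ^+ d) k)
  / denominator d a q k
  * q ^+ ((d * (d - 1) * k) %/ 2).

Lemma denominatorV (F : fieldType) d (a q : F) k :
  denominator d a^-1 q k = denominator d a q k.
Proof.
rewrite /denominator; congr (_ * _); rewrite mulrC; congr (qpochs _ _ _ * qpochs _ _ _);
  by apply: eq_map => j; rewrite exprVn ?invrK.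
Qed.

Lemma summandV (F : fieldType) d (a q : F) k : summand d a^-1 q k = summand d a q k.
Proof.
rewrite /summand denominatorV; do 2 congr (_ * _); congr (_ * (_ * _)).
rewrite mulrC; congr (qpochs _ _ _ * qpochs _ _ _);
  by apply: eq_map => j; rewrite exprVn ?invrK.
Qed.

Lemma big_odd (R : Type) (idx : R) (op : Monoid.law idx) (G : nat -> R) h :
  \big[op/idx]_(j <- index_iota 1 h.*2.+1 | odd j) G j = \big[op/idx]_(i < h) G i.*2.+1.
Proof.
elim: h => [|h IH]; first by rewrite big_ord0 big_geq.
rewrite big_ord_recr /= -IH doubleS big_mkcond /=.
rewrite (@big_nat_recr _ _ _ h.*2.+2) // (@big_nat_recr _ _ _ h.*2.+1) //= odd_double /=.
by rewrite Monoid.mulm1 -big_mkcond.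
Qed.

Lemma big_even (R : Type) (idx : R) (op : Monoid.law idx) (G : nat -> R) h :
  \big[op/idx]_(j <- index_iota 1 h.*2.+1 | ~~ odd j) G j = \big[op/idx]_(i < h) G i.*2.+2.
Proof.
elim: h => [|h IH]; first by rewrite big_ord0 big_geq.
rewrite big_ord_recr /= -IH doubleS big_mkcond /=.
rewrite (@big_nat_recr _ _ _ h.*2.+2) // (@big_nat_recr _ _ _ h.*2.+1) //= odd_double /=.
by rewrite Monoid.mulm1 -big_mkcond.
Qed.

(** * The sum at a = q^n *)

Section AtQn.
Variables (F : fieldType) (q : F) (h m : nat).
Hypothesis q0 : q != 0.
Hypothesis qn1 : forall i, (0 < i)%N -> q ^+ i != 1.
Variables d n : nat.
Hypothesis dE : d = h.*2.+1.
Hypothesis nE : n = (d * m.+1).+1.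
Local Notation a := (q ^+ n).
Local Notation Q := (q ^+ d).

Lemma pos_factor_neq0 i l : 1 - (a ^+ i.*2.+1 * Q) * Q ^+ l != 0.
Proof.
by rewrite -!exprM -!exprD subr_eq0 eq_sym qn1 // dE; nia.
Qed.

(** A vanishing factor would give n (2i+1) = d (l+1); modulo d this says
2i+1 = 0, but 0 < 2i+1 < d. *)
Lemma neg_factor_neq0 i l : (i < h)%N -> 1 - (a ^- i.*2.+1 * Q) * Q ^+ l != 0.
Proof.
move=> ih; rewrite -mulrA -exprS -!exprM; set A := (n * _)%N; set B := (d * _)%N.
have AB : A != B.
  apply/eqP => /(congr1 (modn^~ d)); rewrite /A /B modnMr nE -addn1 mulnDl mul1n.
  by rewrite -mulnA mulnC modnMDl modn_small // dE ltnS ltn_double.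
apply/eqP => /subr0_eq /(congr1 ( *%R (q ^+ A))).
rewrite mulr1 mulVKf ?expf_neq0 // => /expq_inj E.
by rewrite E // eqxx in AB.
Qed.

Lemma qpoch_pos_neq0 i k : qpoch (a ^+ i.*2.+1 * Q) Q k != 0.
Proof. by apply/prodf_neq0 => l _; apply: pos_factor_neq0. Qed.

Lemma qpoch_neg_neq0 i k : (i < h)%N -> qpoch (a ^- i.*2.+1 * Q) Q k != 0.
Proof. by move=> ih; apply/prodf_neq0 => l _; apply: neg_factor_neq0. Qed.

Lemma Q_neq1 i : (0 < i)%N -> Q ^+ i != 1.
Proof. by move=> i0; rewrite -exprM qn1 ?muln_gt0 ?dE. Qed.

Lemma aE : a = Q ^+ m.+1 * q.
Proof. by rewrite nE exprS exprM mulrC. Qed.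

Lemma denominatorE k : denominator d a q k =
  \prod_(i < h) qpoch (a ^+ i.*2.+1 * Q) Q k
  * \prod_(i < h) qpoch (a ^- i.*2.+1 * Q) Q k * qpoch Q Q k.
Proof. by rewrite /denominator /qpochs !big_map !big_filter dE !big_odd. Qed.

Lemma denominator_neq0 k : denominator d a q k != 0.
Proof.
rewrite denominatorE !mulf_neq0 ?qpochq_neq0 //; last exact: Q_neq1.
- by apply/prodf_neq0 => i _; apply: qpoch_pos_neq0.
- by apply/prodf_neq0 => i _; apply: qpoch_neg_neq0.
Qed.

Lemma numerator_pos k :
  qpochs [seq a ^+ j * q^-1 | j <- index_iota 1 d & ~~ odd j] Q k
  = \prod_(i < h) qpoch (a ^+ i.*2.+1 * Q * Q ^+ m) Q k.
Proof.
rewrite /qpochs big_map big_filter {1}dE big_even; apply: eq_bigr => i _; congr qpoch.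
by rewrite [a ^+ i.*2.+2]exprSr {2}aE [Q ^+ m.+1]exprS; field.
Qed.

Variable N : nat.
Hypothesis NE : N = (h.*2 * m.+1).+1.

(** Shifting by one the product over j = 0, ..., 2h turns the numerator bases
into those of the denominator and leaves the terminating base Q^-N. *)
Lemma numerator_neg k :
  qpochs [seq a ^- j * q^-1 | j <- index_iota 1 d & ~~ odd j] Q k * qpoch q^-1 Q k
  = \prod_(i < h) qpoch (a ^- i.*2.+1 * Q * Q ^+ m) Q k * qpoch (Q ^- N) Q k.
Proof.
have a0 : a != 0 by rewrite expf_neq0.
rewrite /qpochs big_map big_filter {1}dE big_even mulrC.
transitivity (\prod_(i < h.+1) qpoch (a ^- i.*2 * q^-1) Q k).
  by rewrite big_ord_recl /= expr0 invr1 mul1r.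
rewrite big_ord_recr /=; congr (_ * _).
  apply: eq_bigr => i _; congr qpoch; rewrite [a ^+ i.*2.+1]exprS invfM.
  rewrite {2}aE invfM [Q ^+ m.+1]exprS; field.
  by rewrite q0 !expf_neq0.
congr qpoch; rewrite -invfM; congr _^-1.
by rewrite aE exprMn -!exprM -mulrA -exprSr -exprD; congr (_ ^+ _); rewrite NE dE; nia.
Qed.

Definition numpoly : {poly F} :=
  'X^h * (1 - q^-1 *: 'X^2)
  * \prod_(i < h) (qpoch_poly (a ^+ i.*2.+1 * Q) Q m
                    * qpoch_poly (a ^- i.*2.+1 * Q) Q m).

Hypothesis h0 : (0 < h)%N.

Lemma numpoly0 : numpoly`_0 = 0.
Proof. by rewrite -horner_coef0 /numpoly !hornerE expr0n eqn0Ngt h0 !mul0r. Qed.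

(** The degree count h + 2 + 2hm <= N is where h >= 1, that is d >= 3, enters. *)
Lemma size_numpoly : (size numpoly <= N.+1)%N.
Proof.
have h1 : (size (1 - q^-1 *: 'X^2 : {poly F})%R <= 3)%N.
  rewrite (leq_trans (size_polyD _ _)) // size_polyN size_polyC oner_neq0 geq_max /=.
  by rewrite (leq_trans (size_scale_leq _ _)) ?size_polyXn.
have h2 : (size (\prod_(i < h) (qpoch_poly (a ^+ i.*2.+1 * Q) Q m
                                  * qpoch_poly (a ^- i.*2.+1 * Q) Q m))%R
    <= (h * m.*2).+1)%N.
  apply: size_prod_ord_leq => i; apply: leq_trans (size_polyMleq _ _) _.
  have := size_qpoch_poly (a ^+ i.*2.+1 * Q) Q m.
  have := size_qpoch_poly (a ^- i.*2.+1 * Q) Q m; lia.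
apply: leq_trans (size_polyMleq _ _) _.
have := size_polyMleq ('X^h) (1 - q^-1 *: 'X^2 : {poly F}); rewrite size_polyXn NE.
have -> : (h.*2 * m.+1 = h * m.*2 + h.*2)%N by nia.
move: h1 h2 h0; move: (h * _)%N => hm; do 3!move: (size _) => ?; lia.
Qed.

Lemma summandE k : summand d a q k =
  ((1 - q)
   * \prod_(i < h) (qpoch (a ^+ i.*2.+1 * Q) Q m * qpoch (a ^- i.*2.+1 * Q) Q m))^-1
  * (signed_qbinom Q N k * numpoly.[Q ^+ k]).
Proof.
have PX : \prod_(i < h) qpoch (a ^+ i.*2.+1 * Q * Q ^+ m) Q k
    / \prod_(i < h) qpoch (a ^+ i.*2.+1 * Q) Q k
  = \prod_(i < h) (qpoch (a ^+ i.*2.+1 * Q * Q ^+ k) Q m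
                    / qpoch (a ^+ i.*2.+1 * Q) Q m).
  rewrite -prodf_div; apply: eq_bigr => i _; apply/eqP.
  by rewrite eqr_div ?qpoch_pos_neq0 // qpoch_shift.
have PY : \prod_(i < h) qpoch (a ^- i.*2.+1 * Q * Q ^+ m) Q k
    / \prod_(i < h) qpoch (a ^- i.*2.+1 * Q) Q k
  = \prod_(i < h) (qpoch (a ^- i.*2.+1 * Q * Q ^+ k) Q m
                    / qpoch (a ^- i.*2.+1 * Q) Q m).
  rewrite -prodf_div; apply: eq_bigr => i _; apply/eqP.
  by rewrite eqr_div ?qpoch_neg_neq0 // qpoch_shift.
have QI : qint q ((2 * d * k)%N%:Z - 1) = (1 - q^-1 * Q ^+ k ^+ 2) / (1 - q).
  rewrite /qint expfzDr // -exprnP -exprnN expr1 -!exprM [_ * q^-1]mulrC.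
  by rewrite (_ : (2 * d * k = d * (k * 2))%N) //; lia.
have E : q ^+ ((d * (d - 1) * k) %/ 2) = Q ^+ k ^+ h.
  rewrite -!exprM; congr (_ ^+ _).
  have -> : (d * (d - 1) * k = (d * k * h) * 2)%N by rewrite dE; nia.
  by rewrite mulnK // !mulnA.
rewrite /summand denominatorE -(mulrA (qpochs _ _ _)) numerator_pos numerator_neg QI E.
have reorder (u v xn xd yn yd t w z : F) :
    u / v * (xn * (yn * t)) / (xd * yd * w) * z
    = v^-1 * (xn / xd) * (yn / yd) * (t / w * (z * u)).
  by rewrite !invfM; ring.
have -> : numpoly.[Q ^+ k] = Q ^+ k ^+ h * (1 - q^-1 * Q ^+ k ^+ 2)
    * (\prod_(i < h) qpoch (a ^+ i.*2.+1 * Q * Q ^+ k) Q m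
       * \prod_(i < h) qpoch (a ^- i.*2.+1 * Q * Q ^+ k) Q m).
  rewrite /numpoly -big_split hornerM horner_prod; congr (_ * _).
    by rewrite !hornerE.
  by apply: eq_bigr => i _; rewrite hornerM !horner_qpoch_poly.
rewrite reorder PX PY !big_split /= !prodfV invfM invfM /signed_qbinom.
ring.
Qed.

Lemma summand_sum0 : \sum_(0 <= k < n) summand d a q k = 0.
Proof.
under eq_bigr => k _ do rewrite summandE.
rewrite -mulr_sumr signed_qbinom_annihilates ?mulr0 ?numpoly0 ?size_numpoly //.
- exact: expf_neq0.
- exact: Q_neq1.
- by rewrite NE nE dE; nia.
Qed.
End AtQn.

(** * Values of fractions at several points *)

Lemma frac_cancel (R : idomainType) (c U V : R) :
  @FracField.tofrac R c != 0 ->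
  @FracField.tofrac R U / @FracField.tofrac R V
  = @FracField.tofrac R (c * U) / @FracField.tofrac R (c * V).
Proof. by move=> c0; rewrite !rmorphM -mulf_div divff ?mul1r. Qed.

Section Specialization.
Variables (R : idomainType) (K : fieldType) (I : Type) (i0 : I).
Variable phi : I -> {rmorphism R -> K}.
Local Notation frac := (@FracField.tofrac R).

(** The same V has to serve for all the morphisms: a fraction whose denominator
is nonzero at every point is what the congruence asks for. *)
Definition specializes (x : {fraction R}) (v : I -> K) :=
  exists U V : R, [/\ forall i, phi i V != 0, x = frac U / frac V
                    & forall i, v i = phi i U / phi i V].

Lemma frac_neq0 V : (forall i, phi i V != 0) -> frac V != 0.
Proof.
by move=> V0; rewrite tofrac_eq0; apply: contraNneq (V0 i0) => ->; rewrite rmorph0.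
Qed.

Lemma specializes_tofrac U : specializes (frac U) (fun i => phi i U).
Proof. by exists U, 1; split=> [i||i]; rewrite ?rmorph1 ?oner_neq0 ?divr1. Qed.

Lemma specializes1 : specializes 1 (fun=> 1).
Proof. by exists 1, 1; split=> [i||i]; rewrite ?rmorph1 ?oner_neq0 ?divr1. Qed.

Lemma specializes0 : specializes 0 (fun=> 0).
Proof. by exists 0, 1; split=> [i||i]; rewrite ?rmorph1 ?oner_neq0 ?rmorph0 ?mul0r. Qed.

Lemma specializes_eq x v w : specializes x v -> v =1 w -> specializes x w.
Proof. by move=> [U [V [V0 xE vE]]] vw; exists U, V; split=> // i; rewrite -vw. Qed.

Lemma specializesD x y v w :
  specializes x v -> specializes y w -> specializes (x + y) (fun i => v i + w i).
Proof.
move=> [U [V [V0 -> vE]]] [U' [V' [V'0 -> wE]]].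
exists (U * V' + U' * V), (V * V'); split=> [i||i].
- by rewrite rmorphM mulf_neq0.
- by rewrite rmorphD !rmorphM addf_div ?frac_neq0.
- by rewrite rmorphD !rmorphM vE wE addf_div.
Qed.

Lemma specializesN x v : specializes x v -> specializes (- x) (fun i => - v i).
Proof.
move=> [U [V [V0 -> vE]]]; exists (- U), V; split=> // [|i]; rewrite rmorphN mulNr //.
by rewrite vE.
Qed.

Lemma specializesM x y v w :
  specializes x v -> specializes y w -> specializes (x * y) (fun i => v i * w i).
Proof.
move=> [U [V [V0 -> vE]]] [U' [V' [V'0 -> wE]]].
exists (U * U'), (V * V'); split=> [i||i]; rewrite ?rmorphM ?mulf_neq0 //=.
- by rewrite mulf_div.
- by rewrite vE wE mulf_div.
Qed.

Lemma specializesV x v :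
  specializes x v -> (forall i, v i != 0) -> specializes x^-1 (fun i => (v i)^-1).
Proof.
move=> [U [V [V0 -> vE]]] v0; exists V, U; split=> [i||i].
- by apply: contraNneq (v0 i) => U0; rewrite vE U0 mul0r.
- by rewrite invf_div.
- by rewrite vE invf_div.
Qed.

Lemma specializesX x v k : specializes x v -> specializes (x ^+ k) (fun i => v i ^+ k).
Proof.
move=> [U [V [V0 -> vE]]]; exists (U ^+ k), (V ^+ k); split=> [i||i].
- by rewrite rmorphXn expf_neq0.
- by rewrite !rmorphXn expr_div_n.
- by rewrite !rmorphXn vE expr_div_n.
Qed.

Lemma specializes_sum (J : Type) (s : seq J) x v :
  (forall j, specializes (x j) (v j)) ->
  specializes (\sum_(j <- s) x j) (fun i => \sum_(j <- s) v j i).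
Proof.
move=> xv; elim: s => [|j s IH].
  by rewrite big_nil; apply: specializes_eq specializes0 _ => i; rewrite big_nil.
rewrite big_cons; apply: specializes_eq (specializesD (xv j) IH) _ => i.
by rewrite big_cons.
Qed.

Lemma specializes_prod (J : Type) (s : seq J) x v :
  (forall j, specializes (x j) (v j)) ->
  specializes (\prod_(j <- s) x j) (fun i => \prod_(j <- s) v j i).
Proof.
move=> xv; elim: s => [|j s IH].
  by rewrite big_nil; apply: specializes_eq specializes1 _ => i; rewrite big_nil.
rewrite big_cons; apply: specializes_eq (specializesM (xv j) IH) _ => i.
by rewrite big_cons.
Qed.

Lemma specializes_qpoch x y v w k :
  specializes x v -> specializes y w ->
  specializes (qpoch x y k) (fun i => qpoch (v i) (w i) k).
Proof.
move=> xv yw; apply: specializes_prod => j.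
apply/(specializesD specializes1)/specializesN/specializesM => //.
exact: specializesX.
Qed.

Lemma specializes_qpochs (J : Type) (s : seq J) x y v w k :
  (forall j, specializes (x j) (v j)) -> specializes y w ->
  specializes (qpochs [seq x j | j <- s] y k)
    (fun i => qpochs [seq v j i | j <- s] (w i) k).
Proof.
move=> xv yw.
rewrite /qpochs big_map.
apply: specializes_eq (specializes_prod s (fun j => specializes_qpoch k (xv j) yw)) _ => i.
by rewrite big_map.
Qed.

Lemma specializes_exprz x v (e : int) :
  specializes x v -> (forall i, v i != 0) -> specializes (x ^ e) (fun i => v i ^ e).
Proof.
move=> xv v0; case: e => k; first exact: specializesX.
by apply: specializesV => [|i]; [exact: specializesX | exact: expf_neq0].
Qed.

Lemma specializes_summand x y v w d k :
  specializes x v -> specializes y w ->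
  (forall i, v i != 0) -> (forall i, w i != 0) -> (forall i, w i != 1) ->
  (forall i, denominator d (v i) (w i) k != 0) ->
  specializes (summand d x y k) (fun i => summand d (v i) (w i) k).
Proof.
move=> xv yw v0 w0 w1 D0.
have yd : specializes (y ^+ d) (fun i => w i ^+ d) by apply: specializesX.
have yV : specializes y^-1 (fun i => (w i)^-1) by apply: specializesV.
have xj j : specializes (x ^+ j) (fun i => v i ^+ j) by apply: specializesX.
have xVj j : specializes (x ^- j) (fun i => v i ^- j).
  by apply: specializesV => // i; rewrite expf_neq0.
have xyM j y' w' : specializes y' w' ->
    specializes (x ^+ j * y') (fun i => v i ^+ j * w' i) by apply: specializesM.
have xyVM j y' w' : specializes y' w' ->
    specializes (x ^- j * y') (fun i => v i ^- j * w' i) by apply: specializesM.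
apply: specializesM (specializesX _ yw); apply: specializesM; last first.
  apply: specializesV D0.
  apply: specializesM; last exact: specializes_qpoch.
  by apply: specializesM; apply: specializes_qpochs => // j; auto.
apply: specializesM.
  apply: specializesM.
    apply/(specializesD specializes1)/specializesN; exact: specializes_exprz.
  apply: specializesV => [|i]; last by rewrite subr_eq0 eq_sym.
  by apply/(specializesD specializes1)/specializesN.
apply: specializesM; last exact: specializes_qpoch.
by apply: specializesM; apply: specializes_qpochs => // j; auto.
Qed.

End Specialization.

(** * Congruences modulo (1 - a q^n) (a - q^n) *)

Local Notation K := {fraction {poly rat}}.
Definition qK : K := @FracField.tofrac {poly rat} 'X.
Definition point n (b : bool) : K := if b then qK ^+ n else qK ^- n.
Definition eval_a n (b : bool) : {rmorphism Qaq -> K} :=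
  horner_eval (point n b) \o map_poly (@FracField.tofrac {poly rat}).

Lemma qK_neq0 : qK != 0.
Proof. by rewrite tofrac_eq0 polyX_eq0. Qed.

Lemma qK_expn_neq1 i : (0 < i)%N -> qK ^+ i != 1.
Proof.
move=> i0; rewrite -(rmorphXn (@FracField.tofrac _)) -(rmorph1 (@FracField.tofrac _)) tofrac_eq.
apply/eqP => /(congr1 (fun p : {poly rat} => p.[0])).
by rewrite !hornerE expr0n eqn0Ngt i0 => /eqP; rewrite eq_sym oner_eq0.
Qed.

Lemma eval_a_pola n b : eval_a n b pola = point n b.
Proof. by rewrite /= /horner_eval map_polyX hornerX. Qed.

Lemma eval_a_polq n b : eval_a n b polq = qK.
Proof. by rewrite /= /horner_eval map_polyC hornerC. Qed.

Definition modulus n : Qaq := (1 - pola * polq ^+ n) * (pola - polq ^+ n).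

Lemma modulusE n : modulus n =
  (- 'X^n)%:P + (1 + 'X^n ^+ 2)%:P * 'X + (- 'X^n)%:P * 'X^2.
Proof.
rewrite /modulus /pola /polq -rmorphXn !rmorphN rmorphD rmorph1 (rmorphXn _ 2).
ring.
Qed.

Lemma coef_modulus n i : (modulus n)`_i =
  if i is 1 then 1 + 'X^n ^+ 2 else - 'X^n *+ ((i == 0)%N || (i == 2)%N).
Proof.
rewrite modulusE !coefD coefC coefCM coefX coefCM coefXn.
case: i => [|[|[|i]]] /=; ring.
Qed.

Lemma size_modulus n : size (modulus n) = 3%N.
Proof.
apply/eqP; rewrite eqn_leq; apply/andP; split.
  apply/leq_sizeP => j; rewrite coef_modulus; case: j => [|[|[|j]]] //= _.
rewrite ltnNge; apply/negP => /leq_sizeP/(_ 2%N isT); rewrite coef_modulus /=.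
by move/eqP; rewrite oppr_eq0 -size_poly_eq0 size_polyXn.
Qed.

Lemma point_inj n : (0 < n)%N -> injective (point n).
Proof.
move=> n0; have E : qK ^+ n <> qK ^- n.
  move/(congr1 ( *%R (qK ^+ n))); rewrite mulfV ?expf_neq0 ?qK_neq0 // -exprD.
  by apply/eqP/qK_expn_neq1; rewrite addn_gt0 n0.
by move=> [] [] //= H; case: E; rewrite H.
Qed.

Lemma size_of_zeros n (W : Qaq) : (0 < n)%N -> (forall b, eval_a n b W = 0) ->
  W != 0 -> (2 < size W)%N.
Proof.
move=> n0 W0 Wn0; pose p := map_poly (@FracField.tofrac {poly rat}) W.
have sp : size p = size W
  by apply: size_map_inj_poly => [x y /eqP|]; rewrite ?tofrac_eq ?rmorph0 // => /eqP.
rewrite -sp; apply: (@max_poly_roots _ p [:: point n true; point n false]).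
- by rewrite -size_poly_eq0 sp size_poly_eq0.
- have z b : root p (point n b) by apply/eqP; exact: W0.
  by rewrite /all !z.
- by rewrite /uniq inE (inj_eq (point_inj n0)).
Qed.

Lemma eval_a_modulus n b : eval_a n b (modulus n) = 0.
Proof.
have q0 := qK_neq0.
rewrite /modulus rmorphM !rmorphB rmorph1 rmorphM !rmorphXn eval_a_pola eval_a_polq.
case: b; rewrite /point; first by rewrite [X in _ * X]subrr mulr0.
by rewrite mulVf ?expf_neq0 // [X in X * _]subrr mul0r.
Qed.

(** If D divides both, the cofactor E of D in the modulus vanishes at both points,
so E has degree at least 2 in a and D lies in Q[q]. Then D divides the
coefficients -q^n and 1 + q^(2n) of the modulus, hence also
(1 + q^(2n)) + q^n (-q^n) = 1. *)
Lemma relatively_prime_modulus n V : (0 < n)%N -> (forall b, eval_a n b V != 0) ->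
  relatively_prime V (modulus n).
Proof.
move=> n0 V0 D [V' VE] [E PE].
have E0 b : eval_a n b E = 0.
  have /eqP := eval_a_modulus n b; rewrite PE rmorphM mulf_eq0 => /orP[] /eqP // D0.
  by have := V0 b; rewrite VE rmorphM D0 mul0r eqxx.
have P0 : modulus n != 0 by rewrite -size_poly_eq0 size_modulus.
have En0 : E != 0 by apply: contraNneq P0 => E0'; rewrite PE E0' mulr0.
have Dn0 : D != 0 by apply: contraNneq P0 => D0; rewrite PE D0 mul0r.
have sE := size_of_zeros n0 E0 En0.
have sD : (size D <= 1)%N.
  have := size_modulus n; rewrite PE size_mul //; move: sE.
  by move: (size E) (size D) => e e'; lia.
have DE := size1_polyC sD.
have cE i : D`_0 * E`_i = (modulus n)`_i by rewrite PE [in RHS]DE coefCM.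
apply/unitrPr; exists (E`_1 + 'X^n * E`_0)%:P.
rewrite DE -rmorphM mulrDr mulrCA !cE !coef_modulus /= mulr1n -(rmorph1 polyC).
by congr (_%:P); ring.
Qed.

(** The leading coefficient -q^n of the modulus in a is not a unit of Q[q], so
division by the modulus costs a factor c, a power of -q^n; being nonzero at both
points, c can be moved to the denominator. *)
Lemma modulus_divides n U : (0 < n)%N -> (forall b, eval_a n b U = 0) ->
  exists c W, (forall b, eval_a n b c != 0) /\ c * U = modulus n * W.
Proof.
move=> n0 U0; have := Pdiv.Idomain.divp_eq U (modulus n).
have -> : lead_coef (modulus n) = - 'X^n.
  by rewrite /lead_coef size_modulus coef_modulus.
move: (scalp _ _) (U %/ _) => k W.
have := @ltn_modpN0 _ U (modulus n); rewrite -size_poly_eq0 size_modulus => /(_ isT).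
move: (U %% _) => r size_r.
rewrite -mul_polyC (rmorphXn polyC) (rmorphN polyC) (rmorphXn polyC n 'X) -/polq.
have [c cE] : exists c, c = (- polq ^+ n) ^+ k by eexists.
rewrite -cE => E.
have rE : r = c * U - W * modulus n by rewrite E addrC addKr.
have r0 : r = 0.
  apply/eqP; apply: contraLR size_r => rn0; rewrite -leqNgt.
  apply: (size_of_zeros n0) => // b.
  by rewrite rE rmorphB (rmorphM _ c) (rmorphM _ W) U0 eval_a_modulus !mulr0 subrr.
exists c, W; split=> [b|]; last by rewrite E r0 addr0 mulrC.
rewrite cE (rmorphXn _ k) rmorphN (rmorphXn _ n) eval_a_polq.
by rewrite expf_neq0 // oppr_eq0 expf_neq0 // qK_neq0.
Qed.

Lemma eqv0_mod_modulus n A : (0 < n)%N -> specializes (eval_a n) A (fun=> 0) ->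
  eqv0_mod A (modulus n).
Proof.
move=> n0 [U [V [V0 AE UV]]].
have U0 b : eval_a n b U = 0.
  by have /esym/eqP := UV b; rewrite mulf_eq0 invr_eq0 (negPf (V0 b)) orbF => /eqP.
have [c [W [c0 WE]]] := modulus_divides n0 U0.
have cV0 b : eval_a n b (c * V) != 0 by rewrite rmorphM mulf_neq0.
exists W, (c * V); split.
- by have := frac_neq0 true cV0; rewrite tofrac_eq0.
- exact: relatively_prime_modulus.
- by rewrite -WE AE; exact: frac_cancel (frac_neq0 true c0).
Qed.

(** * The theorem *)

Theorem theorem7 (d n : nat) (hd : (3 <= d)%N) (hodd : odd d)
    (hn : (1 < n)%N) (hmod : n = 1 %[mod d]) :
  let a := rata in
  let q := ratq in
  eqv0_mod
    (\sum_(0 <= k < n)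
       qint q ((2 * d * k)%N%:Z - 1)
       * (qpochs [seq a ^+ j * q^-1 | j <- index_iota 1 d & ~~ odd j] (q ^+ d) k
          * qpochs [seq a ^- j * q^-1 | j <- index_iota 1 d & ~~ odd j] (q ^+ d) k
          * qpoch q^-1 (q ^+ d) k)
       / (qpochs [seq a ^+ j * q ^+ d | j <- index_iota 1 d & odd j] (q ^+ d) k
          * qpochs [seq a ^- j * q ^+ d | j <- index_iota 1 d & odd j] (q ^+ d) k
          * qpoch (q ^+ d) (q ^+ d) k)
       * q ^+ ((d * (d - 1) * k) %/ 2))
    ((1 - pola * polq ^+ n) * (pola - polq ^+ n)).
Proof.
move=> a q; rewrite -/(modulus n).
have n0 : (0 < n)%N by apply: ltnW.
have [h dE] : exists h, d = h.*2.+1 by exists d./2; rewrite -[LHS]odd_double_half hodd.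
have [m nE] : exists m, n = (d * m.+1).+1.
  have d1 : (1 < d)%N by apply: leq_trans hd.
  have := divn_eq n d; rewrite hmod modn_small // addn1.
  case: (n %/ d)%N => [|m] E; first by rewrite E in hn.
  by exists m; rewrite mulnC.
have h0 : (0 < h)%N by move: hd; rewrite dE; case: (h).
have q0 := qK_neq0; have q1 := qK_expn_neq1.
apply: eqv0_mod_modulus => //.
have inv b k : summand d (point n b) qK k = summand d (qK ^+ n) qK k.
  by case: b; [|exact: summandV].
have inv' b k : denominator d (point n b) qK k = denominator d (qK ^+ n) qK k.
  by case: b; [|exact: denominatorV].
have aS : specializes (eval_a n) a (point n).
  exact: specializes_eq (specializes_tofrac (eval_a n) pola) (eval_a_pola n).
have qS : specializes (eval_a n) q (fun=> qK).
  exact: specializes_eq (specializes_tofrac (eval_a n) polq) (eval_a_polq n).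
have tS k : specializes (eval_a n) (summand d a q k) (fun b => summand d (point n b) qK k).
  apply: (specializes_summand true aS qS) => [b|b|b|b].
  - by case: b; rewrite /point ?invr_eq0 expf_neq0.
  - exact: q0.
  - exact: (q1 1%N).
  - by rewrite inv'; exact: (denominator_neq0 q0 q1 dE nE).
apply: specializes_eq (specializes_sum true (index_iota 0 n) tS) _ => b.
under eq_bigr => k _ do rewrite inv.
by rewrite (summand_sum0 q0 q1 dE nE erefl h0).
Qed.
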